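(* Let $(X,d)$ be a compact metric space, $f:X\to X$ a continuous map, and $u:X\to\mathbb{R}$ a positive continuous function. Let $\mu$ be a Borel probability measure on $X$, $E$ a Borel subset of $X$, and $0<s<\infty$. (1) If $\underline P_\mu(f,x)\le s$ for all $x\in E$, then $\dim_{\rm BSC}E\le s$. (2) If $\underline P_\mu(f,x)\ge s$ for all $x\in E$ and $\mu(E)>0$, then $\dim_{\rm BSC}E\ge s$.
   Context: Bowen balls: for $n\in\mathbb{N}=\{1,2,\dots\}$, $d_n(x,y)=\max\{d(f^kx,f^ky):0\le k\le n-1\}$ and $B_n(x,\varepsilon)=\{y: d_n(x,y)<\varepsilon\}$. A ball $B=B_n(x,\varepsilon)$ is regarded as carrying its length $n(B)=n$ and its center $x$. Put $u(B)=\sup_{y\in B}\sum_{i=0}^{n(B)-1}u(f^iy)$. BS-C dimension: for $Z\subset X$, let $\mathcal W_n(\varepsilon)=\{B_n(x,\varepsilon):x\in Z\}$. For $\alpha>0$, $N\in\mathbb{N}$, $\varepsilon>0$ let $M(Z,\alpha,\varepsilon,N)=\inf_{\mathcal G}\sum_{B\in\mathcal G}\exp(-\alpha u(B))$, the infimum over all finite or countable $\mathcal G\subset\bigcup_{j\ge N}\mathcal W_j(\varepsilon)$ that cover $Z$. Let $m(Z,\alpha,\varepsilon)=\lim_{N\to\infty}M(Z,\alpha,\varepsilon,N)$, $\dim_{\rm BSC}(Z,\varepsilon)=\inf\{\alpha:m(Z,\alpha,\varepsilon)=0\}=\sup\{\alpha:m(Z,\alpha,\varepsilon)=\infty\}$,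 and $\dim_{\rm BSC}Z=\lim_{\varepsilon\to0}\dim_{\rm BSC}(Z,\varepsilon)$. Local lower BS-dimension: $$\underline P_\mu(f,x)=\lim_{\varepsilon\to0}\liminf_{n\to\infty}-\frac{\log\mu(B_n(x,\varepsilon))}{\sum_{i=0}^{n-1}u(f^ix)}.$$ *)

(* Defs.v *)
From HB Require Import structures.
From mathcomp Require Import all_boot all_order all_algebra.
From mathcomp Require Import all_classical all_reals all_analysis.
Set Implicit Arguments.
Unset Strict Implicit.
Unset Printing Implicit Defensive.
Import Order.TTheory GRing.Theory Num.Theory.
Import numFieldNormedType.Exports.
Local Open Scope classical_set_scope.
Local Open Scope ring_scope.

(* The base point is needed because MathComp-Analysis measurable spaces are
   pointed; it is harmless here, as a space carrying a probability measure is
   nonempty. *)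
#[short(type="pointedMetricType")]
HB.structure Definition PointedMetric (K : numDomainType) :=
  { M of Metric K M & Pointed M }.

Notation borelType X := (g_sigma_algebraType (@open X)).

Section BowenBalls.
Context {R : realType} {X : pointedMetricType R}.
Implicit Types (f : X -> X) (u : X -> R) (eps alpha : R) (n N : nat) (Z : set X).

(* Distances are nonnegative, so for n >= 1 the default value 0 of the big
   operator does not affect the maximum. *)
Definition bowen_dist f n (x y : X) : R :=
  \big[Num.max/0]_(k < n) mdist (iter k f x) (iter k f y).

Definition bowen_ball f eps n (x : X) : set X :=
  [set y | bowen_dist f n x y < eps].

Definition birkhoff_sum f u n (x : X) : R := \sum_(i < n) u (iter i f x).

(* A ball carries its length and its center: it is encoded by the pair
   B = (n(B), x), the radius eps being fixed throughout a family. *)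
Definition ball_weight f u eps (B : nat * X) : \bar R :=
  ereal_sup [set (birkhoff_sum f u B.1 y)%:E | y in bowen_ball f eps B.1 B.2].

Definition bsc_cover f Z eps N (G : set (nat * X)) : Prop :=
  [/\ countable G,
      forall B, G B -> [/\ (0 < B.1)%N, (N <= B.1)%N & Z B.2] &
      Z `<=` \bigcup_(B in G) bowen_ball f eps B.1 B.2].

Definition bsc_premeasure f u Z alpha eps N : \bar R :=
  ereal_inf [set \esum_(B in G) expeR (- (alpha%:E * ball_weight f u eps B))%E
            | G in bsc_cover f Z eps N].

Definition bsc_measure f u Z alpha eps : \bar R :=
  limn (bsc_premeasure f u Z alpha eps).

(* The infimum is +oo when no such alpha exists. *)
Definition dim_BSC_at f u Z eps : \bar R :=
  ereal_inf [set alpha%:E | alpha in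
    [set alpha | 0 < alpha /\ bsc_measure f u Z alpha eps = 0%E]].

(* For positive u, dim_BSC_at and the liminf in local_lower_BS increase as eps
   decreases to 0, so that both limits exist in \bar R. *)
Definition dim_BSC f u Z : \bar R :=
  lim (dim_BSC_at f u Z eps @[eps --> 0^'+]).

(* lne 0 = -oo: a ball of measure zero contributes +oo. *)
Definition local_lower_BS f u (mu : probability (borelType X) R) (x : X)
    : \bar R :=
  lim (limn_einf (fun n =>
         - (lne (mu (bowen_ball f eps n x)) / (birkhoff_sum f u n x)%:E))%E
       @[eps --> 0^'+]).

End BowenBalls.

(* Main.v *)
Require Import Defs.
From mathcomp Require Import all_boot all_order all_algebra.
From mathcomp Require Import all_classical all_reals all_analysis.
From mathcomp Require Import ring lra.
Import Order.TTheory GRing.Theory Num.Theory.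
Import numFieldNormedType.Exports.
Local Open Scope classical_set_scope.
Local Open Scope ring_scope.

(** Write S_n u for the Birkhoff sum of u and B_n(x, eps) for a Bowen ball. For
    u > 0, the dimension and the local dimension are suprema over eps > 0
    (dim_BSCE, local_lower_BSE), so both parts are statements about single
    scales.

    Part (1). Let s < t < alpha and fix a scale eps. Every x in E satisfies
    mu (B_n(x, eps / 2)) >= exp (- t * S_n u x) for infinitely many n. For fixed
    n, choose a maximal disjoint family of balls B_n(x, eps / 2) whose centers
    satisfy this inequality: the concentric balls of radius eps cover all such
    centers, and the sum of exp (- t * S_n u x) over the family is at most 1,
    since mu is a probability. If a > 0 bounds u from below, replacing t by
    alpha gains a factor q ^+ n with q = exp (- (alpha - t) * a) < 1. Summing
    over n >= N gives a cover of E whose total weight is the tail of a geometric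
    series, so that the BS-C measure of E at alpha vanishes (bsc_measure_eq0).
    As disjointness is only required for a fixed length n, no Vitali-type
    covering argument is needed.

    Part (2). Let t < r < s. The set E is the union over k of the sets E_k of
    the x such that mu (B_n(x, 1 / (k + 1))) <= exp (- r * S_n u x) for all
    n > k, so some E_k has positive outer measure. If B is a ball of length
    n > k and small radius eps that contains some y in E_k, then
    mu B <= exp (- r * S_n u y), while uniform continuity and positivity of u
    give u(B) <= (1 + g) * S_n u y with (1 + g) * t = r. Hence, for alpha <= t,
    the weight exp (- alpha * u(B)) is at least mu B, and any cover of E by such
    balls has total weight at least the outer measure of E_k
    (mu_ext_le_premeasure, bsc_measure_neq0). *)

(** * Bowen balls and Birkhoff sums *)

Section BowenBalls.
Context {R : realType} {X : pointedMetricType R}.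
Implicit Types (f : X -> X) (u : X -> R) (n : nat) (x y z : X).

Lemma bowen_ballP {f eps} n x y : 0 < eps ->
  bowen_ball f eps n x y <->
  forall k, (k < n)%N -> mdist (iter k f x) (iter k f y) < eps.
Proof.
move=> eps0; rewrite /bowen_ball/bowen_dist /=; split.
  by move=> /bigmax_ltP[_ h] k kn; exact: (h (Ordinal kn)).
by move=> h; apply/bigmax_ltP; split => // i _; exact: h.
Qed.

Lemma bowen_ball_center {f eps} n x : 0 < eps -> bowen_ball f eps n x x.
Proof. by move=> e0; apply/bowen_ballP => // k _; rewrite mdistxx. Qed.

Lemma bowen_ball_sym {f eps} n x y :
  bowen_ball f eps n x y -> bowen_ball f eps n y x.
Proof.
rewrite /bowen_ball/bowen_dist /=; congr (_ < _).
by apply: eq_bigr => k _; rewrite metric_sym.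
Qed.

Lemma bowen_ball_triangle {f e1 e2} n x y z : 0 < e1 -> 0 < e2 ->
  bowen_ball f e1 n x y -> bowen_ball f e2 n y z ->
  bowen_ball f (e1 + e2) n x z.
Proof.
move=> e10 e20 /bowen_ballP-/(_ e10) xy /bowen_ballP-/(_ e20) yz.
apply/bowen_ballP => [|k kn]; first exact: addr_gt0.
rewrite (le_lt_trans (metric_triangle _ (iter k f y) _))//.
by apply: ltrD; [exact: xy|exact: yz].
Qed.

Lemma sub_bowen_ball {f e1 e2} n x : e1 <= e2 ->
  bowen_ball f e1 n x `<=` bowen_ball f e2 n x.
Proof. by move=> e12 y; rewrite /bowen_ball /= => /lt_le_trans; apply. Qed.

Lemma continuous_iter {f} k : continuous f -> continuous (iter k f).
Proof.
move=> cf; elim: k => [|k IH] x; first exact: cvg_id.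
by apply: (@continuous_comp _ _ _ (iter k f) f); [exact: IH|exact: cf].
Qed.

Lemma open_mball x (e : R) : open [set y | mdist x y < e].
Proof.
rewrite openE => y /= xye; apply/nbhs_ballP; exists (e - mdist x y) => /=.
  by rewrite subr_gt0.
move=> z; rewrite ballEmdist /= => yz.
by rewrite (le_lt_trans (metric_triangle _ y _))// -ltrBrDl.
Qed.

Lemma open_bowen_ball {f eps} n x : continuous f -> 0 < eps ->
  open (bowen_ball f eps n x).
Proof.
move=> cf e0.
suff -> : bowen_ball f eps n x =
    \bigcap_(k in `I_n) (iter k f @^-1` [set y | mdist (iter k f x) y < eps]).
  rewrite bigcap_mkord; elim/big_ind: _ => [|A B|k _]; first exact: openT.
    exact: openI.
  apply: open_comp; last exact: open_mball.
  by move=> y _; exact: continuous_iter.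
by apply/seteqP; split => [y /bowen_ballP-/(_ e0) h k /h|y h];
  last apply/bowen_ballP.
Qed.

Lemma measurable_bowen_ball {f eps} n x : continuous f -> 0 < eps ->
  measurable (bowen_ball f eps n x : set (borelType X)).
Proof.
by move=> cf e0; apply: sub_sigma_algebra; exact: open_bowen_ball.
Qed.

Lemma birkhoff_sum_gt0 {f u} n x : (forall y, 0 < u y) -> (0 < n)%N ->
  0 < birkhoff_sum f u n x.
Proof.
move=> u0; case: n => // n _; rewrite /birkhoff_sum big_ord_recl /=.
by apply: ltr_pwDl => //; apply: sumr_ge0 => i _; exact: ltW.
Qed.

Lemma birkhoff_sum_bounds {f u a b} n x : (forall y, a <= u y <= b) ->
  n%:R * a <= birkhoff_sum f u n x <= n%:R * b.
Proof.
move=> h; have sumE c : n%:R * c = \sum_(i < n) c.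
  by rewrite sumr_const card_ord mulr_natl.
by rewrite /birkhoff_sum !sumE; apply/andP; split; apply: ler_sum => i _;
  have /andP[] := h (iter i f x).
Qed.

(** The weight u(B) of a ball is at least the Birkhoff sum at its center. *)
Lemma birkhoff_sum_le_weight {f u eps} n x : 0 < eps ->
  ((birkhoff_sum f u n x)%:E <= ball_weight f u eps (n, x))%E.
Proof.
by move=> e0; apply: ereal_sup_ubound; exists x => //; exact: bowen_ball_center.
Qed.

(** On a compact space a positive continuous function varies by an arbitrarily
    small factor on small balls, uniformly in the center. *)
Lemma compact_relative_variation {u} (g : R) : compact [set: X] ->
  continuous u -> (forall x, 0 < u x) -> 0 < g ->
  exists2 e, 0 < e & forall y z, mdist y z < e -> u z <= (1 + g) * u y.
Proof.
move=> /compact_near_coveringP cptX cu u0 g0.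
suff /(cptX R 0^'+ (fun e x => forall z, mdist x z < e ->
    u z <= (1 + g) * u x) _) H : forall x, [set: X] x ->
    \forall x' \near x & e \near 0^'+,
    forall z, mdist x' z < e -> u z <= (1 + g) * u x'.
  have [e [e0 He]] := filter_ex (filterI (nbhs_right_gt 0) H).
  by exists e => // y z; exact: He.
move=> x _.
(* c is chosen so that u x + c = (1 + g) * (u x - c) *)
pose c := g * u x / (2 + g).
have c0 : 0 < c by rewrite divr_gt0 ?mulr_gt0// addr_gt0.
have cE : (1 + g) * (u x - c) = u x + c by rewrite /c; field; lra.
have /nbhs_ballP[r /= r0 xr] : \forall y \near x, `|u x - u y| < c.
  by move/cvgrPdist_lt : (cu x); exact.
have r2 : 0 < r / 2 by rewrite divr_gt0.
near=> x' e => /=.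
have er : e < r / 2 by near: e; exact: nbhs_right_lt.
have xx' : ball x (r / 2) x' by near: x'; exact: nbhsx_ballx.
move=> z x'z.
have : ball x r z.
  rewrite (splitr r); apply: ball_triangle xx' _; rewrite ballEmdist /=.
  exact: lt_trans x'z er.
move/xr => /= xz; have /xr /= xx : ball x r x'.
  by apply: le_ball xx'; lra.
move: xz xx; rewrite !ltr_norml => /andP[h1 h2] /andP[h3 h4].
apply: (@le_trans _ _ (u x + c)); first lra.
by rewrite -cE ler_pM2l; lra.
Unshelve. all: by end_near. Qed.

Lemma compact_bounds {u} : compact [set: X] ->
  continuous u -> (forall x, 0 < u x) ->
  exists a b, 0 < a /\ forall x, a <= u x <= b.
Proof.
move=> /compact_near_coveringP cptX cu u0.
suff /(cptX R 0^'+ (fun e x => e <= u x <= e^-1) _) H : forall x,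
    [set: X] x -> \forall x' \near x & e \near 0^'+, e <= u x' <= e^-1.
  have [e [e0 He]] := filter_ex (filterI (nbhs_right_gt 0) H).
  by exists e, e^-1; split => // x; exact: He.
move=> x _.
have /cvgrPdist_lt/(_ (u x / 2)) := cu x.
move=> /(_ (divr_gt0 (u0 x) (ltr0n _ 2))) ux.
near=> x' e => /=.
have : `|u x - u x'| < u x / 2 by near: x'.
rewrite ltr_norml => /andP[h1 h2].
have e0 : 0 < e by near: e; exact: nbhs_right_gt.
have h3 : e < u x / 2.
  by near: e; apply: nbhs_right_lt; rewrite divr_gt0.
have h4 : e < (2 * u x)^-1.
  by near: e; apply: nbhs_right_lt; rewrite invr_gt0 mulr_gt0.
apply/andP => /=; split; first lra.
have ux0 := u0 x; apply: (@le_trans _ _ (2 * u x)); first lra.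
by rewrite -[leLHS]invrK lef_pV2 ?posrE ?invr_gt0 ?mulr_gt0// ltW.
Unshelve. all: by end_near. Qed.

End BowenBalls.

(** * Local dimension *)

Section LocalRate.
Context {R : realType} {X : pointedMetricType R}.
Implicit Types (f : X -> X) (u : X -> R) (mu : probability (borelType X) R).

Lemma lne_ratio_le {m S : R} (t : R) : 0 <= m -> 0 < S ->
  (- (lne m%:E / S%:E) <= t%:E)%E = (expR (- (t * S)) <= m).
Proof.
move=> m0 S0; have [->|mn0] := eqVneq m 0.
  rewrite le0_lneNy// inver gt_eqF// gt0_mulNye ?lte_fin ?invr_gt0//=.
  by rewrite leye_eq /= [RHS]leNgt expR_gt0.
have mgt0 : 0 < m by rewrite lt_neqAle eq_sym mn0.
rewrite lne_EFin// inver gt_eqF// -EFinM -EFinN lee_fin.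
rewrite -{2}(lnK mgt0) ler_expR.
by rewrite lerNl ler_pdivlMr// mulNr.
Qed.

Lemma lne_ratio_ge {m S : R} (t : R) : 0 <= m -> 0 < S ->
  (t%:E <= - (lne m%:E / S%:E))%E = (m <= expR (- (t * S))).
Proof.
move=> m0 S0; have [->|mn0] := eqVneq m 0.
  rewrite le0_lneNy// inver gt_eqF// gt0_mulNye ?lte_fin ?invr_gt0//=.
  by rewrite leey expR_ge0.
have mgt0 : 0 < m by rewrite lt_neqAle eq_sym mn0.
rewrite lne_EFin// inver gt_eqF// -EFinM -EFinN lee_fin.
by rewrite -{2}(lnK mgt0) ler_expR lerNr ler_pdivrMr// mulNr.
Qed.

(** The quantity whose liminf in n, followed by the limit as eps tends to 0, is
    the local lower BS-dimension. *)
Definition local_rate f u mu x eps n : \bar R :=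
  (- (lne (mu (bowen_ball f eps n x)) / (birkhoff_sum f u n x)%:E))%E.

Lemma fine_bowen_ball {f eps} mu n x : continuous f -> 0 < eps ->
  exists2 r : R, 0 <= r & mu (bowen_ball f eps n x) = r%:E.
Proof.
move=> cf e0; exists (fine (mu (bowen_ball f eps n x))).
  by rewrite fine_ge0.
by rewrite fineK// fin_num_measure//; exact: measurable_bowen_ball.
Qed.

Lemma local_rate_le {f u mu x eps n} (t : R) : continuous f ->
  (forall y, 0 < u y) -> 0 < eps -> (0 < n)%N ->
  (local_rate f u mu x eps n <= t%:E)%E =
  ((expR (- (t * birkhoff_sum f u n x)))%:E <= mu (bowen_ball f eps n x))%E.
Proof.
move=> cf u0 e0 n0; rewrite /local_rate.
have [r r0 ->] := fine_bowen_ball mu n x cf e0.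
by rewrite lee_fin lne_ratio_le// birkhoff_sum_gt0.
Qed.

Lemma local_rate_ge {f u mu x eps n} (t : R) : continuous f ->
  (forall y, 0 < u y) -> 0 < eps -> (0 < n)%N ->
  (t%:E <= local_rate f u mu x eps n)%E =
  (mu (bowen_ball f eps n x) <= (expR (- (t * birkhoff_sum f u n x)))%:E)%E.
Proof.
move=> cf u0 e0 n0; rewrite /local_rate.
have [r r0 ->] := fine_bowen_ball mu n x cf e0.
by rewrite lee_fin lne_ratio_ge// birkhoff_sum_gt0.
Qed.

(** For n = 0 the Birkhoff sum vanishes and its inverse is +oo, which does not
    affect monotonicity. *)
Lemma le_local_rate {f u mu x e1 e2} n : continuous f ->
  (forall y, 0 < u y) -> 0 < e1 -> e1 <= e2 ->
  (local_rate f u mu x e2 n <= local_rate f u mu x e1 n)%E.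
Proof.
move=> cf u0 e10 e12; rewrite /local_rate leeN2; apply: lee_wpmul2r.
  by rewrite inve_ge0 lee_fin /birkhoff_sum; apply: sumr_ge0 => i _; exact: ltW.
rewrite lee_lne ?in_itv /= ?leey ?andbT//; have e20 : 0 < e2 := lt_le_trans e10 e12.
apply: le_measure.
- exact: mem_set (measurable_bowen_ball n x cf e10).
- exact: mem_set (measurable_bowen_ball n x cf e20).
- exact: sub_bowen_ball.
Qed.

Lemma limn_einf_sup_einfs (v : (\bar R)^nat) :
  limn_einf v = ereal_sup (range (einfs v)).
Proof. by rewrite limn_einf_lim; apply/cvg_lim => //; exact: cvg_einfs_sup. Qed.

Lemma le_limn_einf (v w : (\bar R)^nat) :
  (forall n, v n <= w n)%E -> (limn_einf v <= limn_einf w)%E.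
Proof.
move=> vw; rewrite !limn_einf_lim; apply: lee_lim; try exact: is_cvg_einfs.
apply: nearW => n; apply: le_ereal_inf_tmp => _ /= [m nm] <-.
by apply: le_trans (vw m); apply: ereal_inf_lbound; exists m.
Qed.

Lemma local_lower_BSE f u mu x : continuous f -> (forall y, 0 < u y) ->
  local_lower_BS f u mu x =
  ereal_sup [set limn_einf (local_rate f u mu x eps) | eps in `]0, +oo[ ].
Proof.
move=> cf u0; apply/cvg_lim => //.
apply: (nonincreasing_at_right_cvge (BInfty R false)) => // e1 e2.
rewrite !in_itv /= !andbT => e10 _ e12.
by apply: le_limn_einf => n; exact: le_local_rate.
Qed.

Lemma local_lower_BS_le {f u mu x} {s t : R} eps N : continuous f ->
  (forall y, 0 < u y) -> (local_lower_BS f u mu x <= s%:E)%E -> s < t ->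
  0 < eps -> exists2 n, (N <= n)%N & (local_rate f u mu x eps n <= t%:E)%E.
Proof.
move=> cf u0; rewrite local_lower_BSE// => hs st e0.
have : (einfs (local_rate f u mu x eps) N < t%:E)%E.
  rewrite (@le_lt_trans _ _ s%:E) ?lte_fin// (le_trans _ hs)//.
  apply: (@le_trans _ _ (limn_einf (local_rate f u mu x eps))).
    by rewrite limn_einf_sup_einfs; apply: ereal_sup_ubound; exists N.
  by apply: ereal_sup_ubound; exists eps => //=; rewrite in_itv /= e0.
by move=> /ereal_inf_lt[_ /= [n Nn] <- /ltW]; exists n.
Qed.

Lemma local_lower_BS_ge {f u mu x} {s t : R} : continuous f ->
  (forall y, 0 < u y) -> (s%:E <= local_lower_BS f u mu x)%E -> t < s ->
  exists2 eps, 0 < eps & exists N, forall n, (N <= n)%N ->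
    (t%:E <= local_rate f u mu x eps n)%E.
Proof.
move=> cf u0; rewrite local_lower_BSE// => hs ts.
have ts' : (t%:E < s%:E)%E by rewrite lte_fin.
have /ereal_sup_gt[_ /= [eps e0 <-]] := lt_le_trans ts' hs.
move: e0; rewrite in_itv /= andbT => e0; rewrite limn_einf_sup_einfs.
move=> /ereal_sup_gt[_ /= [N _ <-] /ltW hN]; exists eps => //; exists N => n Nn.
by apply: le_trans hN _; apply: ereal_inf_lbound; exists n.
Qed.

End LocalRate.

(** * BS-C measure and dimension *)

Section Dimension.
Context {R : realType} {X : pointedMetricType R}.
Implicit Types (f : X -> X) (u : X -> R) (Z : set X).

Lemma bsc_premeasure_ge0 f u Z alpha eps N :
  (0 <= bsc_premeasure f u Z alpha eps N)%E.
Proof.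
apply: le_ereal_inf_tmp => _ /= [G _ <-].
by apply: esum_ge0 => B _; exact: expeR_ge0.
Qed.

Lemma nondecreasing_bsc_premeasure f u Z alpha eps :
  nondecreasing_seq (bsc_premeasure f u Z alpha eps).
Proof.
move=> m n mn; apply: ereal_inf_le_tmp => _ /= [G [cG GN ZG] <-].
exists G => //; split => // B GB; have [B0 nB BZ] := GN B GB.
by split => //; exact: leq_trans nB.
Qed.

Lemma is_cvg_bsc_premeasure f u Z alpha eps :
  cvgn (bsc_premeasure f u Z alpha eps).
Proof.
by apply: ereal_nondecreasing_is_cvgn; exact: nondecreasing_bsc_premeasure.
Qed.

Lemma bsc_premeasure_le_measure f u Z alpha eps N :
  (bsc_premeasure f u Z alpha eps N <= bsc_measure f u Z alpha eps)%E.
Proof.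
have ndM := nondecreasing_bsc_premeasure f u Z alpha eps.
rewrite /bsc_measure (cvg_lim _ (ereal_nondecreasing_cvgn ndM))//.
by apply: ereal_sup_ubound; exists N.
Qed.

Lemma le_bsc_measure {f u Z alpha e1 e2} : 0 < alpha -> e1 <= e2 ->
  (bsc_measure f u Z alpha e2 <= bsc_measure f u Z alpha e1)%E.
Proof.
move=> a0 e12; apply: lee_lim; try exact: is_cvg_bsc_premeasure.
apply: nearW => N; apply: le_ereal_inf_tmp => _ /= [G [cG GN ZG] <-].
apply: (@le_trans _ _
    (\esum_(B in G) expeR (- (alpha%:E * ball_weight f u e2 B)))%E).
  apply: ereal_inf_lbound; exists G => //; split => // z /ZG[B GB Bz].
  by exists B => //; exact: sub_bowen_ball Bz.
apply: le_esum => B _; rewrite lee_expeR leeN2.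
apply: lee_wpmul2l; first by rewrite lee_fin ltW.
by apply: ereal_sup_le => _ /= [y By <-]; exists y => //; exact: sub_bowen_ball By.
Qed.

Lemma dim_BSC_at_ge0 f u Z eps : (0 <= dim_BSC_at f u Z eps)%E.
Proof.
by apply: le_ereal_inf_tmp => _ /= [a [a0 _] <-]; rewrite lee_fin ltW.
Qed.

Lemma dim_BSCE f u Z :
  dim_BSC f u Z = ereal_sup [set dim_BSC_at f u Z eps | eps in `]0, +oo[ ].
Proof.
apply/cvg_lim => //.
apply: (nonincreasing_at_right_cvge (f := dim_BSC_at f u Z) (BInfty R false)).
  by [].
move=> e1 e2; rewrite !in_itv /= !andbT => e10 _ e12.
apply: ereal_inf_le_tmp => _ /= [a [a0 ma] <-]; exists a; last by [].
split; first by [].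
apply/eqP; rewrite eq_le -{1}ma; apply/andP; split.
  exact: le_bsc_measure.
apply: le_trans (bsc_premeasure_le_measure f u Z a e2 0).
exact: bsc_premeasure_ge0.
Qed.

Lemma dim_BSC_le f u Z (s : R) :
  (forall alpha eps, s < alpha -> 0 < eps -> bsc_measure f u Z alpha eps = 0%E) ->
  0 < s -> (dim_BSC f u Z <= s%:E)%E.
Proof.
move=> h s0; rewrite dim_BSCE; apply: ge_ereal_sup => _ /= [eps + <-].
rewrite in_itv /= andbT => e0; apply/lee_addgt0Pr => d d0.
rewrite -EFinD; apply: ereal_inf_lbound; exists (s + d) => //; split.
  exact: addr_gt0.
by apply: h => //; rewrite ltrDl.
Qed.

Lemma dim_BSC_ge f u Z (s : R) :
  (forall t, 0 < t -> t < s -> exists2 eps, 0 < eps & forall alpha,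
    0 < alpha -> alpha <= t -> bsc_measure f u Z alpha eps <> 0%E) ->
  (s%:E <= dim_BSC f u Z)%E.
Proof.
move=> h; rewrite dim_BSCE; set D := ereal_sup _.
have D_ge eps : 0 < eps -> (dim_BSC_at f u Z eps <= D)%E.
  by move=> e0; apply: ereal_sup_ubound; exists eps => //=; rewrite in_itv /= e0.
have D0 : (0 <= D)%E by apply: le_trans (D_ge 1 ltr01); exact: dim_BSC_at_ge0.
apply/lee_addgt0Pr => d d0; have [sd|sd] := leP s d.
  by rewrite (@le_trans _ _ d%:E) ?lee_fin// leeDr.
rewrite -leeBlDr// -EFinB.
have [|//|eps e0 he] := h (s - d); rewrite ?subr_gt0 ?ltrBlDr ?ltrDl//.
apply: le_trans (D_ge _ e0); apply: le_ereal_inf_tmp => _ /= [a [a0 ma] <-].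
by rewrite lee_fin leNgt; apply/negP => /ltW/he; exact.
Qed.

End Dimension.

(** * Upper bound for the dimension *)

Section UpperBound.
Import finmap.
Context {R : realType}.

Lemma finite_disjoint_measure_ge {d} {T : measurableType d}
    (P : probability T R) {I : choiceType} (D : set I) (F : I -> set T) (c : R) :
  0 < c -> trivIset D F -> (forall i, D i -> measurable (F i)) ->
  (forall i, D i -> (c%:E <= P (F i))%E) -> finite_set D.
Proof.
move=> c0 tD mF cF; apply: contrapT => /infinite_set_fset infD.
have [B BD cB] := infD (Num.trunc c^-1).+1.
have mB : forall i, [set` B] i -> measurable (F i) by move=> i /BD; exact: mF.
have : (P (\bigcup_(i in [set` B]) F i) <= 1)%E.
  by apply: probability_le1; exact: fin_bigcup_measurable.
rewrite measure_fin_bigcup//; last exact: sub_trivIset tD.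
rewrite fsbig_finite//= set_fsetK leNgt => /negP; apply.
apply: (@lt_le_trans _ _ (\sum_(i <- B) c%:E)%E); last first.
  by rewrite big_seq [leRHS]big_seq; apply: lee_sum => i /BD; exact: cF.
rewrite sumEFin lte_fin big_const_seq count_predT iter_addr_0 -mulr_natl.
rewrite -ltr_pdivrMr// mul1r.
have := truncnS_gt c^-1 => /lt_le_trans; apply; by rewrite ler_nat.
Qed.

Context {X : pointedMetricType R}.
Implicit Types (f : X -> X) (u : X -> R) (mu : probability (borelType X) R).

(** A maximal disjoint family of balls of radius eps / 2 centered in A: the
    balls of radius eps with the same centers cover A, and the measures of the
    disjoint balls add up to at most 1. The lower bound c on the measures makes
    the family finite. *)
Lemma disjoint_bowen_balls {f eps} mu n (A : set X) (c : R) : continuous f ->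
  0 < eps -> 0 < c ->
  (forall x, A x -> (c%:E <= mu (bowen_ball f (eps / 2) n x))%E) ->
  exists D : set X, [/\ finite_set D, D `<=` A,
    A `<=` \bigcup_(x in D) bowen_ball f eps n x &
    (\sum_(x \in D) mu (bowen_ball f (eps / 2) n x) <= 1)%E].
Proof.
move=> cf e0 c0 cA; have e20 : 0 < eps / 2 by rewrite divr_gt0.
pose F x : set (borelType X) := bowen_ball f (eps / 2) n x.
have mF x : measurable (F x) by exact: measurable_bowen_ball.
have [D [DA tD maxD]] := ex_maximal_disjoint_subcollection F A.
have finD : finite_set D.
  by apply: (finite_disjoint_measure_ge mu D F c) => // x /DA; exact: cA.
exists D; split => //; last first.
  rewrite -(measure_fin_bigcup mu finD tD (fun x _ => mF x)); apply: probability_le1.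
  exact: fin_bigcup_measurable.
move=> y Ay; apply: contrapT => ny.
have ball_far x : D x -> F x `&` F y = set0.
  move=> Dx; rewrite -subset0 => z [xz yz]; apply: ny; exists x => //.
  rewrite (splitr eps); apply: (bowen_ball_triangle n x z y) => //.
  exact: bowen_ball_sym.
(* otherwise y could be added to D, against maximality *)
apply: (maxD (y |` D)).
- rewrite properEneq; split; last exact: subsetUr.
  apply/eqP => DyD; apply: ny; exists y; last exact: bowen_ball_center.
  by rewrite DyD; left.
- by rewrite subUset; split => // _ ->.
apply/trivIsetP => i j [->|Di] [->|Dj]; rewrite ?eqxx//.
- by rewrite setIC => _; exact: ball_far.
- by move=> _; exact: ball_far.
- by move/trivIsetP : tD; exact.
Qed.

(** For s < t < alpha, each point of Z lies, for infinitely many lengths n, in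
    the set A n of the x with exp (- t * S_n u x) <= mu (B_n(x, eps / 2)), which
    is covered by balls of total weight at most q ^+ n. *)
Lemma bsc_measure_eq0 {f u} mu (Z : set X) (s alpha eps : R) :
  compact [set: X] -> continuous f -> continuous u -> (forall x, 0 < u x) ->
  0 < s -> s < alpha -> 0 < eps ->
  (forall x, Z x -> (local_lower_BS f u mu x <= s%:E)%E) ->
  bsc_measure f u Z alpha eps = 0%E.
Proof.
move=> cptX cf cu u0 s0 sa e0 hZ.
have e20 : 0 < eps / 2 by rewrite divr_gt0.
have [a [b [a0 ab]]] := compact_bounds cptX cu u0.
pose t := (s + alpha) / 2.
have st : s < t by rewrite /t; lra.
have ta : t < alpha by rewrite /t; lra.
have t0 : 0 < t by lra.
pose q := expR (- ((alpha - t) * a)).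
have q0 : 0 <= q by exact: expR_ge0.
have q1 : q < 1 by rewrite expR_lt1 oppr_lt0 mulr_gt0// subr_gt0.
pose A n := [set x | Z x /\ ((expR (- (t * birkhoff_sum f u n x)))%:E <=
                             mu (bowen_ball f (eps / 2) n x))%E].
have /choice[D DP] n : exists D : set X, [/\ finite_set D, D `<=` A n,
    A n `<=` \bigcup_(x in D) bowen_ball f eps n x &
    (\sum_(x \in D) mu (bowen_ball f (eps / 2) n x) <= 1)%E].
  apply: (disjoint_bowen_balls mu n (A n) (expR (- (t * (n%:R * b))))) => //.
    exact: expR_gt0.
  move=> x [_ /(le_trans _)]; apply; rewrite lee_fin ler_expR lerN2.
  by rewrite ler_pM2l//; have /andP[] := birkhoff_sum_bounds (f := f) n x ab.
have weight_le n x : D n x ->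
    (expeR (- (alpha%:E * ball_weight f u eps (n, x))) <=
     (q ^+ n)%:E * mu (bowen_ball f (eps / 2) n x))%E.
  move=> Dx; have [_ /(_ _ Dx)[_ hx] _ _] := DP n.
  apply: (@le_trans _ _ (expR (- (alpha * birkhoff_sum f u n x)))%:E).
    rewrite -[leRHS]/(expeR (- (alpha * _))%:E) lee_expeR EFinN EFinM leeN2.
    apply: lee_wpmul2l; first by rewrite lee_fin; lra.
    exact: birkhoff_sum_le_weight.
  apply: (@le_trans _ _ ((q ^+ n)%:E *
      (expR (- (t * birkhoff_sum f u n x)))%:E)%E); last first.
    by apply: lee_wpmul2l hx; rewrite lee_fin exprn_ge0.
  rewrite -EFinM lee_fin /q -expRM_natl -expRD ler_expR.
  have /andP[hS _] := birkhoff_sum_bounds (f := f) n x ab.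
  have := ler_wpM2l (ltW (_ : 0 < alpha - t)) hS.
  by rewrite subr_gt0 => /(_ ta); lra.
have premeasure_le N :
    (bsc_premeasure f u Z alpha eps N <= \sum_(N <= n <oo) (q ^+ n)%:E)%E.
  pose I := [set n | (N <= n)%N && (0 < n)%N].
  apply: (@le_trans _ _ (\esum_(B in I `*`` D)
      expeR (- (alpha%:E * ball_weight f u eps (B.1, B.2))))%E).
    apply: ereal_inf_lbound; exists (I `*`` D); last first.
      by apply: eq_esum => -[].
    split.
    - by apply: countableXR => // n _; apply: finite_set_countable; case: (DP n).
    - move=> [n x] [/= /andP[Nn n0] Dx]; split => //.
      by have [_ /(_ _ Dx)[]] := DP n.
    - move=> x Zx.
      have [n] := local_lower_BS_le (eps / 2) (maxn N 1) cf u0 (hZ x Zx) st e20.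
      rewrite geq_max => /andP[Nn n0]; rewrite local_rate_le// => hx.
      have [_ _ /(_ x)[]// y Dy yx _] := DP n.
      by exists (n, y) => //; split => //; apply/andP; split.
  rewrite -(esum_esum (a := fun n x =>
    expeR (- (alpha%:E * ball_weight f u eps (n, x)))%E)); last first.
    by move=> *; exact: expeR_ge0.
  apply: (@le_trans _ _ (\esum_(n in I) (q ^+ n)%:E)).
    apply: le_esum => n _; have [finD _ _ D1] := DP n.
    apply: (@le_trans _ _ (\esum_(x in D n)
        ((q ^+ n)%:E * mu (bowen_ball f (eps / 2) n x))%E)).
      by apply: le_esum => x; exact: weight_le.
    rewrite esum_fset//; last first.
      by move=> x _; rewrite mule_ge0// lee_fin exprn_ge0.
    rewrite -ge0_mule_fsumr; last by move=> x; exact: measure_ge0.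
    by rewrite -[leRHS]mule1; apply: lee_wpmul2l => //; rewrite lee_fin exprn_ge0.
  rewrite eseries_cond nneseries_esum; last by move=> *; rewrite lee_fin exprn_ge0.
  apply: ereal_sup_le => _ /= [F [finF FI] <-]; exists F => //; split => //.
  by move=> n /FI /andP[].
apply/cvg_lim => //.
apply: (@squeeze_cvge _ _ _ _ (cst 0%E) _
    (fun N => (\sum_(N <= n <oo) (q ^+ n)%:E)%E)).
- by apply: nearW => N; rewrite bsc_premeasure_ge0 premeasure_le.
- exact: cvg_cst.
apply: nneseries_tail_cvg => [|n _]; last by rewrite lee_fin exprn_ge0.
apply: (@le_lt_trans _ _ (1 * (1 - q)^-1)%:E); last exact: ltry.
apply: lime_le.
  by apply: is_cvg_nneseries => n _ _; rewrite lee_fin exprn_ge0.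
apply: nearW => n; rewrite sumEFin lee_fin.
apply: le_trans (geometric_le_lim n ler01 _ _); last 2 first.
- by rewrite expR_gt0.
- by rewrite ger0_norm.
by rewrite /series /=; apply: ler_sum => i _; rewrite mul1r.
Qed.

End UpperBound.

(** * Lower bound for the dimension *)

Section LowerBound.
Context {R : realType}.
Local Open Scope measure_scope.

(** Countable subadditivity over an arbitrary countable index set. The outer
    measure allows for a non-measurable A. *)
Lemma mu_ext_le_esum {d} {T : measurableType d} (mu : {measure set T -> \bar R})
    {I : pointedType} (G : set I) (F : I -> set T) (A : set T) :
  countable G -> (forall i, measurable (F i)) ->
  A `<=` \bigcup_(i in G) F i -> (mu^* A <= \esum_(i in G) mu (F i))%E.
Proof.
move=> /countable_bijP[N]; rewrite card_eq_sym => /card_set_bijP[e bij_e] mF AF.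
rewrite (reindex_esum N G e)//.
pose F' k := if k \in N then F (e k) else set0.
have -> : \esum_(k in N) mu (F (e k)) = (\sum_(k <oo) mu (F' k))%E.
  rewrite nneseries_esumT// esum_mkcond; apply: eq_esum => k _.
  by rewrite /F'; case: ifPn => // _; rewrite measure0.
apply: ereal_inf_lbound; exists F' => //; split.
  by move=> k; rewrite /F'; case: ifPn.
move=> x /AF[i Gi Fix]; have [k Nk eki] := set_bij_surj bij_e Gi.
by exists k => //; rewrite /F' mem_set// eki.
Qed.

Context {X : pointedMetricType R}.
Implicit Types (f : X -> X) (u : X -> R) (mu : probability (borelType X) R).

(** The points x of Z such that mu (B_n(x, 1 / (k + 1))) <= exp (- t * S_n u x)
    for all n > k. The single index k bounds both the scale and the length, so
    that countably many such sets suffice. *)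
Definition uniform_decay_set f u mu (Z : set X) (t : R) (k : nat) : set X :=
  [set x | Z x /\ forall n, (k < n)%N ->
    (mu (bowen_ball f k.+1%:R^-1 n x) <=
     (expR (- (t * birkhoff_sum f u n x)))%:E)%E].

Lemma bigcup_uniform_decay_set f u mu (Z : set X) (s t : R) : continuous f ->
  (forall x, 0 < u x) -> t < s ->
  (forall x, Z x -> (s%:E <= local_lower_BS f u mu x)%E) ->
  Z `<=` \bigcup_k uniform_decay_set f u mu Z t k.
Proof.
move=> cf u0 ts hZ x Zx.
have [eps e0 [N hN]] := local_lower_BS_ge cf u0 (hZ x Zx) ts.
pose k := maxn N (Num.trunc eps^-1).
have k0 : 0 < k.+1%:R^-1 :> R by rewrite invr_gt0.
have ke : k.+1%:R^-1 <= eps.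
  rewrite -[leRHS]invrK lef_pV2 ?posrE ?invr_gt0//.
  apply: le_trans (ltW (truncnS_gt eps^-1)) _.
  by rewrite ler_nat ltnS leq_maxr.
exists k => //; split => // n kn.
have Nn : (N <= n)%N by rewrite (leq_trans _ (ltnW kn))// leq_maxl.
rewrite -local_rate_ge//; last exact: leq_ltn_trans kn.
by apply: le_trans (hN n Nn) _; exact: le_local_rate.
Qed.

(** A mass distribution principle: each ball B of a cover that meets the set of
    uniform decay has a weight exp (- alpha * u(B)) at least its measure. *)
Lemma mu_ext_le_premeasure {f u} mu (Z : set X) (alpha g t eps : R) (k : nat) :
  continuous f -> (forall x, 0 < u x) ->
  0 < alpha -> alpha * (1 + g) <= t ->
  0 < eps -> eps + eps <= k.+1%:R^-1 ->
  (forall y z, mdist y z < eps + eps -> u z <= (1 + g) * u y) ->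
  (mu^* (uniform_decay_set f u mu Z t k : set (borelType X)) <=
   bsc_premeasure f u Z alpha eps k.+1)%E.
Proof.
move=> cf u0 a0 agt e0 ek hu; have ee0 : 0 < eps + eps by rewrite addr_gt0.
apply: le_ereal_inf_tmp => _ /= [G [cG GN ZG] <-].
set D := uniform_decay_set f u mu Z t k.
(* the balls of G that miss D are replaced by the empty set *)
pose F (B : nat * X) : set (borelType X) :=
  if `[< G B /\ bowen_ball f eps B.1 B.2 `&` D !=set0 >]
  then bowen_ball f eps B.1 B.2 else set0.
apply: (@le_trans _ _ (\esum_(B in G) mu (F B))).
  apply: mu_ext_le_esum => // [B|y Dy].
    by rewrite /F; case: ifP => // _; exact: measurable_bowen_ball.
  have [B GB By] := ZG y Dy.1; exists B => //.
  by rewrite /F; case: asboolP => // -[]; split => //; exists y.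
apply: le_esum => -[n x] GB; rewrite /F /=.
case: asboolP => [[_ [y [xy [Zy Dy]]]]|_]; last by rewrite measure0 expeR_ge0.
have [/= n0 kn _] := GN _ GB.
have near_y z : bowen_ball f eps n x z -> bowen_ball f (eps + eps) n y z.
  by move=> xz; apply: bowen_ball_triangle xz => //; exact: bowen_ball_sym.
have S0 := birkhoff_sum_gt0 (f := f) n y u0 n0.
have weight_le : (ball_weight f u eps (n, x) <=
    ((1 + g) * birkhoff_sum f u n y)%:E)%E.
  apply: ge_ereal_sup => _ /= [z /near_y/bowen_ballP-/(_ ee0) yz <-].
  rewrite lee_fin /birkhoff_sum mulr_sumr; apply: ler_sum => i _.
  by apply: hu; exact: yz.
apply: (@le_trans _ _ (mu (bowen_ball f k.+1%:R^-1 n y))).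
  apply: le_measure; try by apply: mem_set; exact: measurable_bowen_ball.
  by move=> z /near_y; exact: sub_bowen_ball.
apply: (le_trans (Dy n kn)).
rewrite -[leLHS]/(expeR (- (t * _))%:E) lee_expeR EFinN leeN2.
apply: (@le_trans _ _ (alpha%:E * ((1 + g) * birkhoff_sum f u n y)%:E)%E).
  by apply: lee_wpmul2l weight_le; rewrite lee_fin ltW.
by rewrite -EFinM lee_fin mulrA ler_wpM2r// ltW.
Qed.

Lemma bsc_measure_neq0 {f u} mu (Z : set (borelType X)) (s t : R) :
  compact [set: X] -> continuous f -> continuous u -> (forall x, 0 < u x) ->
  measurable Z -> 0 < t -> t < s ->
  (forall x, Z x -> (s%:E <= local_lower_BS f u mu x)%E) -> (0 < mu Z)%E ->
  exists2 eps, 0 < eps & forall alpha, 0 < alpha -> alpha <= t ->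
    bsc_measure f u (Z : set X) alpha eps <> 0%E.
Proof.
move=> cptX cf cu u0 mZ t0 ts hZ muZ.
(* the slack between t and s absorbs the variation of u on small balls *)
pose r := (t + s) / 2; pose g := r / t - 1.
have rs : r < s by rewrite /r; lra.
have g0 : 0 < g by rewrite subr_gt0 ltr_pdivlMr// /r; lra.
have tg : t * (1 + g) = r by rewrite /g; field; rewrite gt_eqF.
have [k Dk] : exists k,
    (0 < mu^* (uniform_decay_set f u mu Z r k : set (borelType X)))%E.
  apply: contrapT => /forallNP D0.
  have : (mu^* Z <= 0)%E.
    apply: (@le_trans _ _ (mu^* (\bigcup_k
        (uniform_decay_set f u mu Z r k : set (borelType X))))).
      apply: le_outer_measure; exact: bigcup_uniform_decay_set rs hZ.
    apply: le_trans (outer_measure_sigma_subadditive _ _) _.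
    rewrite eseries0// => k _ _; apply/eqP; rewrite eq_le outer_measure_ge0 andbT.
    by rewrite leNgt; apply/negP; exact: D0.
  by rewrite measurable_mu_extE// leNgt muZ.
have [e e0 he] := compact_relative_variation g cptX cu u0 g0.
have k0 : 0 < k.+1%:R^-1 :> R by rewrite invr_gt0.
pose eps := Num.min e k.+1%:R^-1 / 2.
have eps2 : eps + eps = Num.min e k.+1%:R^-1 by rewrite -splitr.
exists eps; first by rewrite divr_gt0// lt_min e0.
move=> alpha a0 alphat /eqP; apply/negP; rewrite gt_eqF//.
apply: lt_le_trans (bsc_premeasure_le_measure f u Z alpha eps k.+1).
apply: (lt_le_trans Dk).
apply: (mu_ext_le_premeasure mu Z alpha g r) => //.
- by rewrite -tg ler_wpM2r// addr_ge0// ltW.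
- by rewrite divr_gt0// lt_min e0.
- by rewrite eps2 ge_min lexx orbT.
- by move=> y z; rewrite eps2 lt_min => /andP[/he].
Qed.

End LowerBound.

Theorem theorem7p1 (R : realType) (X : pointedMetricType R)
    (cptX : compact [set: X])
    (f : X -> X) (cf : continuous f)
    (u : X -> R) (cu : continuous u) (u_gt0 : forall x, 0 < u x)
    (mu : probability (borelType X) R)
    (E : set (borelType X)) (mE : measurable E)
    (s : R) (s_gt0 : 0 < s) :
  ((forall x : X, E x -> (local_lower_BS f u mu x <= s%:E)%E) ->
     (dim_BSC f u E <= s%:E)%E) /\
  ((forall x : X, E x -> (s%:E <= local_lower_BS f u mu x)%E) ->
     (0 < mu E)%E ->
     (s%:E <= dim_BSC f u E)%E).
Proof.
split=> [hE|hE muE].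
  apply: dim_BSC_le => // alpha eps s_lt e0.
  exact: (bsc_measure_eq0 mu E s).
by apply: dim_BSC_ge => t t0 ts; exact: (bsc_measure_neq0 mu E s).
Qed.
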